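(* Let $d \in \{2,3\}$ and let $n \geq 1$ be an integer. Suppose that for each $1 \leq k \leq n$ we have a real number $\lambda_k > 0$ and a smooth function $\phi_k : \mathbb{R}^d \rightarrow \mathbb{R}$ satisfying $-\Delta \phi_k = \lambda_k \phi_k$ on all of $\mathbb{R}^d$, and let $a_1, \dots, a_n \in \mathbb{R}$. Then the function $$ f(x) = \sum_{k=1}^n a_k \phi_k(x)$$ has a zero in every ball $B \subset \mathbb{R}^d$ with radius $$ r = 2\pi \sum_{k=1}^n \frac{1}{\sqrt{\lambda_k}}.$$
   Context: $\Delta = \sum_{i=1}^d \partial^2/\partial x_i^2$ is the Laplacian on $\mathbb{R}^d$. The $\lambda_k$ are not assumed distinct. No growth or boundedness condition is imposed on the $\phi_k$. The ball of radius $r$ centered at $x$ is the set of all points at Euclidean distance at most $r$ from $x$. *)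

(* Defs.v *)
From mathcomp Require Export all_boot all_order all_algebra.
From mathcomp Require Export all_classical all_reals all_analysis.

Set Implicit Arguments.
Unset Strict Implicit.
Unset Printing Implicit Defensive.

Export Order.TTheory GRing.Theory Num.Theory.
Export numFieldNormedType.Exports.

Local Open Scope classical_set_scope.
Local Open Scope ring_scope.

(* The norm of the library on 'rV[R]_d is the sup norm: it induces the topology
   used for limits and derivatives, but its balls are cubes. Hence the separate
   Euclidean norm. *)
Definition enorm (R : realType) (d : nat) (x : 'rV[R]_d) : R :=
  Num.sqrt (\sum_(i < d) x ord0 i ^+ 2).

Definition closed_eball (R : realType) (d : nat) (c : 'rV[R]_d) (r : R) :
    set 'rV[R]_d :=
  [set x | enorm (x - c) <= r].

Definition partial (R : realType) (d : nat) (i : 'I_d) (f : 'rV[R]_d -> R) :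
    'rV[R]_d -> R :=
  fun x => 'D_(delta_mx ord0 i) f x.

Definition laplacian (R : realType) (d : nat) (f : 'rV[R]_d -> R) :
    'rV[R]_d -> R :=
  fun x => \sum_(i < d) partial i (partial i f) x.

(* The empty list of directions gives f itself. [derive] is a total operator,
   so the existence of each partial derivative has to be required explicitly. *)
Definition smooth (R : realType) (d : nat) (f : 'rV[R]_d -> R) : Prop :=
  forall s : seq 'I_d,
    continuous (foldr (@partial R d) f s) /\
    (forall (i : 'I_d) (x : 'rV[R]_d),
       derivable (foldr (@partial R d) f s) x (delta_mx ord0 i)).

(* Main.v *)
(* Every phi with -Delta phi = lam phi is annihilated by a weighted average over
   the boundary of the cube of half-side (pi / 2) sqrt (d / lam): pair phi with the
   product of the cosines cos (sqrt (lam / d) y_i), which is positive inside the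
   cube, vanishes on its boundary and has the same eigenvalue; Green's identity
   leaves only boundary terms with positive weights. The cube lies in the ball of
   radius pi d / (2 sqrt lam), at most 2 pi / sqrt lam for d <= 4. Averages commute,
   so composing those of lam_1, ..., lam_n kills f while averaging its values over
   the ball of radius r; hence f cannot be positive there.

   All averages are finite: the cosine product is sampled on a grid and Green's
   identity becomes an exact summation by parts, so phi is annihilated up to an
   error that tends to 0 with the mesh, uniformly on compact sets. *)
Require Import Defs.
From mathcomp Require Import ring lra.

Set Implicit Arguments.
Unset Strict Implicit.
Unset Printing Implicit Defensive.

Local Open Scope classical_set_scope.
Local Open Scope ring_scope.

(** * Finitely supported measures, averages and convolutions *)

Section Weights.
Variables (R : realType) (V : zmodType).
Implicit Types (w : seq (R * V)) (g : V -> R) (S : set V).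

(** A list of pairs (mass, shift) encodes a finitely supported measure, repeated shifts being
    allowed; this integrates the translate of [g] by [x]. *)
Definition weighted_sum w g (x : V) : R := \sum_(p <- w) p.1 * g (x + p.2).

Definition conv w1 w2 : seq (R * V) :=
  [seq (p.1 * q.1, p.2 + q.2) | p <- w1, q <- w2].

Definition average S w :=
  [/\ forall p, p \in w -> 0 <= p.1,
      forall p, p \in w -> S p.2 & \sum_(p <- w) p.1 = 1].

Lemma weighted_sum_conv w1 w2 g x :
  weighted_sum (conv w1 w2) g x = weighted_sum w1 (weighted_sum w2 g) x.
Proof.
rewrite /weighted_sum /conv big_allpairs_dep /=; apply: eq_bigr => p _.
by rewrite mulr_sumr; apply: eq_bigr => q _; rewrite mulrA addrA.
Qed.

Lemma eq_weighted_sum w g1 g2 : g1 =1 g2 -> weighted_sum w g1 =1 weighted_sum w g2.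
Proof. by move=> eqg x; apply: eq_bigr => p _; rewrite eqg. Qed.

Lemma weighted_sumC w1 w2 g x :
  weighted_sum w1 (weighted_sum w2 g) x = weighted_sum w2 (weighted_sum w1 g) x.
Proof.
rewrite /weighted_sum.
under eq_bigr do rewrite mulr_sumr.
rewrite exchange_big /=; apply: eq_bigr => q _.
rewrite mulr_sumr; apply: eq_bigr => p _.
by rewrite mulrCA addrAC.
Qed.

Lemma weighted_sumZ w (c : R) g x :
  weighted_sum w (fun y => c * g y) x = c * weighted_sum w g x.
Proof.
by rewrite /weighted_sum mulr_sumr; apply: eq_bigr => p _; rewrite mulrCA.
Qed.

Lemma weighted_sum_sum (I : Type) (r : seq I) (g : I -> V -> R) w x :
  weighted_sum w (fun y => \sum_(i <- r) g i y) x =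
  \sum_(i <- r) weighted_sum w (g i) x.
Proof.
rewrite /weighted_sum; under eq_bigr do rewrite mulr_sumr.
by rewrite exchange_big.
Qed.

Lemma average_conv S1 S2 S w1 w2 :
  (forall x y, S1 x -> S2 y -> S (x + y)) ->
  average S1 w1 -> average S2 w2 -> average S (conv w1 w2).
Proof.
move=> S12 [w1_ge0 w1S w1_1] [w2_ge0 w2S w2_1]; split.
- by move=> _ /allpairsP[[p q] /= [/w1_ge0 ? /w2_ge0 ? ->]] /=; rewrite mulr_ge0.
- by move=> _ /allpairsP[[p q] /= [/w1S ? /w2S ? ->]]; apply: S12.
rewrite /conv big_allpairs_dep /=.
by under eq_bigr do rewrite -mulr_sumr w2_1 mulr1.
Qed.

Lemma average_sub S S' w : S `<=` S' -> average S w -> average S' w.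
Proof. by move=> SS' [w_ge0 wS w1]; split=> // p /wS/SS'. Qed.

Lemma average_unit S : S 0 -> average S [:: (1, 0)].
Proof.
by move=> S0; split=> [p|p|]; rewrite ?big_seq1 // inE => /eqP-> //=.
Qed.

Lemma average_le_weighted_sum S w g x m : average S w ->
  (forall y, S y -> m <= g (x + y)) -> m <= weighted_sum w g x.
Proof.
move=> [w_ge0 wS w1] mg; rewrite -[m]mul1r -w1 mulr_suml /weighted_sum.
rewrite big_seq [leRHS]big_seq; apply: ler_sum => p pw.
by rewrite ler_wpM2l ?w_ge0// mg//; apply: wS.
Qed.

Lemma average_norm_weighted_sum S w g x m : average S w ->
  (forall y, S y -> `|g (x + y)| <= m) -> `|weighted_sum w g x| <= m.
Proof.
move=> [w_ge0 wS w1] mg; rewrite -[m]mul1r -w1 mulr_suml /weighted_sum.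
apply: le_trans (ler_norm_sum _ _ _) _.
rewrite big_seq [leRHS]big_seq; apply: ler_sum => p pw.
by rewrite normrM ger0_norm ?w_ge0// ler_wpM2l ?w_ge0// mg//; apply: wS.
Qed.

Definition mixture n (w : 'I_n -> seq (R * V)) : seq (R * V) :=
  [seq (n%:R^-1 * p.1, p.2) | i <- enum 'I_n, p <- w i].

Lemma weighted_sum_mixture n (w : 'I_n -> seq (R * V)) g x :
  weighted_sum (mixture w) g x = n%:R^-1 * \sum_(i < n) weighted_sum (w i) g x.
Proof.
rewrite /weighted_sum /mixture big_allpairs_dep /= big_enum /= mulr_sumr.
apply: eq_bigr => i _.
by rewrite mulr_sumr; apply: eq_bigr => p _; rewrite mulrA.
Qed.

Lemma average_mixture S n (w : 'I_n -> seq (R * V)) : (0 < n)%N ->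
  (forall i, average S (w i)) -> average S (mixture w).
Proof.
move=> n_gt0 avw; split.
- move=> _ /allpairsPdep[i [p [_ pw ->]]] /=.
  by have [w_ge0 _ _] := avw i; rewrite mulr_ge0 ?invr_ge0 ?w_ge0.
- by move=> _ /allpairsPdep[i [p [_ pw ->]]]; have [_ wS _] := avw i; exact: (wS p).
rewrite /mixture big_allpairs_dep /= big_enum /= (eq_bigr (fun=> n%:R^-1)).
  by rewrite sumr_const card_ord -[LHS]mulr_natr mulVf// pnatr_eq0 -lt0n.
by move=> i _; have [_ _ wi1] := avw i; rewrite -mulr_sumr wi1 mulr1.
Qed.

Definition conv_all (I : Type) (w : I -> seq (R * V)) (s : seq I) :=
  foldr (fun i => conv (w i)) [:: (1, 0)] s.

(** Since averages commute, any chosen factor can be made to act on [g] first. This serves for the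
    axes of a cube and for the terms of an eigenfunction sum. *)
Lemma weighted_sum_conv_all_rem (I : eqType) (w : I -> seq (R * V)) s i g x :
  i \in s ->
  weighted_sum (conv_all w s) g x =
  weighted_sum (conv_all w (rem i s)) (weighted_sum (w i) g) x.
Proof.
elim: s x => // j s IH x; rewrite inE /= weighted_sum_conv.
have [-> _|neq_ij /= js] := eqVneq i j; first by rewrite weighted_sumC.
by rewrite weighted_sum_conv; apply: eq_weighted_sum => y; apply: IH.
Qed.

End Weights.

(** * Sine weights and Green's identity on a segment *)

Section SineWeights.
Variables (R : realType) (V : lmodType R).
Implicit Types (g : V -> R) (e x : V) (h : R) (n : nat).

(** Discrete Green identity: the sines satisfy [s_(k+2) + s_k = 2 cos t s_(k+1)], so in the
    induction on [n] only boundary terms survive. *)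
Lemma sin_summation_by_parts (t : R) (u : nat -> R) n :
  \sum_(k < n) sin (k.+1%:R * t) * (u k.+2 + u k - 2 * cos t * u k.+1) =
  sin t * u 0%N + sin (n%:R * t) * u n.+1 - sin (n.+1%:R * t) * u n.
Proof.
elim: n => [|n IH]; first by rewrite big_ord0 mul0r sin0 mul1r; ring.
rewrite big_ord_recr /= IH.
have sinS : sin (n.+2%:R * t) = 2 * cos t * sin (n.+1%:R * t) - sin (n%:R * t).
  rewrite (_ : n.+2%:R * t = n.+1%:R * t + t); last by rewrite -!natr1; ring.
  rewrite (_ : n%:R * t = n.+1%:R * t - t); last by rewrite -!natr1; ring.
  by rewrite sinD sinB; ring.
by rewrite sinS; ring.
Qed.

(** The step for which the sampled sine runs through half a period, vanishing at the indices 0 and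
    [n.+1]; recentred at 0 it is a cosine. *)
Definition angle n : R := pi / n.+1%:R.

Definition sin_mass n : R := \sum_(k < n) sin (k.+1%:R * angle n).

(* The [n.+2] nodes [k * h - half_width h n], [k <= n.+1], are symmetric about 0;
   the sine weights vanish at the two extreme ones. *)
Definition half_width h n : R := n.+1%:R * h / 2.

Definition sin_weights e h n : seq (R * V) :=
  [seq ((sin_mass n)^-1 * sin (k.+1%:R * angle n),
        (k.+1%:R * h - half_width h n) *: e) | k : 'I_n <- enum 'I_n].

Definition end_weights e h n : seq (R * V) :=
  [:: (2^-1, half_width h n *: e); (2^-1, - half_width h n *: e)].

(** Discrete counterpart of [g'' + mu g] along [e], up to a factor [h ^+ 2]; its coefficient puts
    the sampled sine in the kernel. *)
Definition second_diff e h n g x : R :=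
  g (x + h *: e) + g (x - h *: e) - 2 * cos (angle n) * g x.

Lemma sin_angle_gt0 n (k : 'I_n) : 0 < sin (k.+1%:R * angle n).
Proof.
apply: sin_gt0_pi; rewrite mulr_gt0 ?divr_gt0 ?pi_gt0//=.
by rewrite mulrCA gtr_pMr ?pi_gt0// ltr_pdivrMr// mul1r ltr_nat ltnS.
Qed.

Lemma sin_mass_gt0 n : (0 < n)%N -> 0 < sin_mass n.
Proof.
case: n => // n _; rewrite /sin_mass big_ord_recl ltr_pwDl ?sin_angle_gt0//.
by apply: sumr_ge0 => k _; rewrite ltW ?sin_angle_gt0.
Qed.

Lemma sin_angleM n : sin (n%:R * angle n) = sin (angle n).
Proof.
have -> : n%:R * angle n = - angle n + pi.
  by rewrite /angle -natr1; field; rewrite natr1 pnatr_eq0.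
by rewrite sinDpi sinN opprK.
Qed.

Lemma sin_angleS n : sin (n.+1%:R * angle n) = 0.
Proof. by rewrite /angle mulrCA mulfV ?pnatr_eq0// mulr1 sinpi. Qed.

Lemma sin_massE n : sin_mass n * (2 - 2 * cos (angle n)) = 2 * sin (angle n).
Proof.
have := sin_summation_by_parts (angle n) (fun=> 1) n.
rewrite sin_angleM sin_angleS -mulr_suml => eqs.
transitivity (sin_mass n * (1 + 1 - 2 * cos (angle n) * 1)); first by ring.
by rewrite eqs; ring.
Qed.

(** Both boundary terms of the summation by parts carry [sin (angle n)], hence the equal end
    weights; [sin_massE], the case of a constant sequence, normalises them. *)
Lemma weighted_sum_sin_second_diff e h n g x : (0 < n)%N ->
  weighted_sum (sin_weights e h n) (second_diff e h n g) x =
  (2 - 2 * cos (angle n)) * weighted_sum (end_weights e h n) g x.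
Proof.
move=> n_gt0; have m_neq0 := lt0r_neq0 (sin_mass_gt0 n_gt0).
pose u k := g (x + (k%:R * h - half_width h n) *: e).
have := sin_summation_by_parts (angle n) u n.
rewrite sin_angleM sin_angleS mul0r subr0 -mulrDr => eqs.
rewrite /weighted_sum /sin_weights big_map big_enum /=.
transitivity ((sin_mass n)^-1 * (sin (angle n) * (u 0%N + u n.+1))).
  rewrite -eqs mulr_sumr; apply: eq_bigr => k _.
  rewrite -[LHS]mulrA; congr (_ * (_ * _)).
  set t := k.+1%:R * h - half_width h n.
  have tS : k.+2%:R * h - half_width h n = t + h by rewrite /t -!natr1; ring.
  have tP : k%:R * h - half_width h n = t - h by rewrite /t -!natr1; ring.
  by rewrite /second_diff /u tS tP -/t (scalerDl e t) (scalerBl t) !addrA.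
rewrite !big_cons big_nil /= addr0 -mulrDr.
have -> : u 0%N = g (x + - half_width h n *: e) by rewrite /u mul0r add0r.
have -> : u n.+1 = g (x + half_width h n *: e).
  by rewrite /u /half_width; congr (g (_ + _ *: _)); field.
rewrite (_ : 2 - 2 * cos (angle n) = (sin_mass n)^-1 * (2 * sin (angle n))).
  by field.
by rewrite -sin_massE mulKf.
Qed.

Lemma average_sin_weights S e h n : (0 < n)%N -> 0 <= h ->
  (forall t, `|t| <= half_width h n -> S (t *: e)) ->
  average S (sin_weights e h n).
Proof.
move=> n_gt0 h_ge0 HS; have m_gt0 := sin_mass_gt0 n_gt0; split.
- move=> _ /mapP[k _ ->] /=.
  by rewrite mulr_ge0 ?invr_ge0 ?ltW ?sin_angle_gt0.
- move=> _ /mapP[k _ ->] /=; apply: HS; rewrite /half_width ler_norml.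
  have : k.+1%:R * h <= n.+1%:R * h by rewrite ler_wpM2r// ler_nat ltnW// ltnS.
  have : 0 <= k.+1%:R * h by rewrite mulr_ge0.
  by move=> *; lra.
by rewrite /sin_weights big_map big_enum /= -mulr_sumr mulVf ?gt_eqF.
Qed.

Lemma average_end_weights S e h n : 0 <= h ->
  (forall t, `|t| <= half_width h n -> S (t *: e)) ->
  average S (end_weights e h n).
Proof.
move=> h_ge0 HS.
have a_ge0 : 0 <= half_width h n by rewrite divr_ge0 ?mulr_ge0.
split=> [p|p|].
- by rewrite !inE => /orP[] /eqP-> /=; rewrite invr_ge0.
- by rewrite !inE => /orP[] /eqP-> /=; apply: HS; rewrite ?normrN ger0_norm.
by rewrite !big_cons big_nil /=; lra.
Qed.

End SineWeights.

(** * Product weights on a cube and averages over its boundary *)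

Section CubeWeights.
Variables (R : realType) (d : nat).
Implicit Types (g : 'rV[R]_d -> R) (x : 'rV[R]_d) (h : R) (n : nat).
Implicit Types (i : 'I_d) (s : seq 'I_d).

Definition unitv i : 'rV[R]_d := delta_mx ord0 i.

Definition box (r : 'I_d -> R) : set 'rV[R]_d :=
  [set y | forall j, `|y ord0 j| <= r j].

Definition prod_weights h n : seq 'I_d -> seq (R * 'rV[R]_d) :=
  conv_all (fun i => sin_weights (unitv i) h n).

(** Component [i] lives on the two faces orthogonal to axis [i]; its density there, the product of
    the other sine weights, is up to a constant the normal derivative of the cosine product. *)
Definition cube_weights h n : seq (R * 'rV[R]_d) :=
  mixture (fun i => conv (end_weights (unitv i) h n)
                         (prod_weights h n (rem i (enum 'I_d)))).

(** Green's identity on the cube: in term [i] the sine factor of axis [i] is moved innermost, where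
    it turns the second difference into end values. *)
Lemma weighted_sum_cube_weights h n g x : (0 < n)%N ->
  (2 - 2 * cos (angle R n)) * weighted_sum (cube_weights h n) g x =
  d%:R^-1 * weighted_sum (prod_weights h n (enum 'I_d))
    (fun y => \sum_(i < d) second_diff (unitv i) h n g y) x.
Proof.
move=> n_gt0; rewrite weighted_sum_mixture mulrCA; congr (_ * _).
rewrite weighted_sum_sum mulr_sumr; apply: eq_bigr => i _.
rewrite (weighted_sum_conv_all_rem _ _ _ (mem_enum _ i)) weighted_sum_conv.
rewrite weighted_sumC -weighted_sumZ.
by apply: eq_weighted_sum => y; rewrite weighted_sum_sin_second_diff.
Qed.

Lemma box_unitv i (a t : R) : `|t| <= a ->
  box (fun j => a * (i == j)%:R) (t *: unitv i).
Proof.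
move=> ta j; rewrite !mxE eqxx /= eq_sym.
by case: (_ == _); rewrite ?mulr1 ?mulr0 ?normr0.
Qed.

Lemma boxD r1 r2 r x y : (forall j, r1 j + r2 j = r j) ->
  box r1 x -> box r2 y -> box r (x + y).
Proof.
move=> r12 xr1 yr2 j; rewrite mxE -r12.
by apply: le_trans (ler_normD _ _) _; rewrite lerD.
Qed.

(** Counting multiplicities carries the induction and records that an axis missing from [s]
    contributes width zero. *)
Lemma average_prod_weights h n s : (0 < n)%N -> 0 <= h ->
  average (box (fun j => half_width h n * (count_mem j s)%:R))
          (prod_weights h n s).
Proof.
move=> n_gt0 h_ge0; elim: s => [|i s IH] /=.
  by apply: average_unit => j; rewrite mxE normr0 mulr0.
apply: average_conv IH; last first.
  by apply: average_sin_weights => // t; apply: box_unitv.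
by move=> x y; apply: boxD => j; rewrite natrD mulrDr.
Qed.

Lemma average_prod_weights_enum h n : (0 < n)%N -> 0 <= h ->
  average (box (fun=> half_width h n)) (prod_weights h n (enum 'I_d)).
Proof.
move=> n_gt0 h_ge0; apply: average_sub (average_prod_weights _ n_gt0 h_ge0).
move=> x xb j; apply: le_trans (xb j) _.
by rewrite count_uniq_mem ?enum_uniq// mem_enum mulr1.
Qed.

Lemma average_cube_weights h n : (0 < d)%N -> (0 < n)%N -> 0 <= h ->
  average (box (fun=> half_width h n)) (cube_weights h n).
Proof.
move=> d_gt0 n_gt0 h_ge0; apply: average_mixture => // i.
have avi : average (box (fun j => half_width h n * (i == j)%:R))
    (end_weights (unitv i) h n).
  by apply: average_end_weights => // t; apply: box_unitv.
apply: average_conv avi (average_prod_weights (rem i (enum 'I_d)) n_gt0 h_ge0).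
move=> x y; apply: boxD => j.
(* The product has width zero along the removed axis, exactly the one that the end weights fill. *)
rewrite -mulrDr -natrD count_mem_rem count_uniq_mem ?enum_uniq// mem_enum.
by case: (i == j); rewrite /= mulr1.
Qed.

End CubeWeights.

(** * The Euclidean norm and compactness of its closed balls *)

Lemma translation_continuous (R : realType) (V : normedModType R) (c : V) :
  continuous (fun x : V => x + c).
Proof. by move=> x; apply: cvgD; [exact: cvg_id|exact: cvg_cst]. Qed.

Section EuclideanNorm.
Variables (R : realType) (d : nat).
Implicit Types (x y c : 'rV[R]_d).

Lemma enorm_ge0 x : 0 <= enorm x.
Proof. exact: sqrtr_ge0. Qed.

Lemma sqr_enorm x : enorm x ^+ 2 = \sum_(i < d) x ord0 i ^+ 2.
Proof. by rewrite sqr_sqrtr// sumr_ge0// => i _; rewrite sqr_ge0. Qed.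

Lemma normr_coord_le_enorm x i : `|x ord0 i| <= enorm x.
Proof.
rewrite -(@ler_pXn2r _ 2) ?nnegrE ?enorm_ge0// real_normK ?num_real// sqr_enorm.
by rewrite (bigD1 i)//= lerDl sumr_ge0// => j _; rewrite sqr_ge0.
Qed.

Lemma enormZ (t : R) x : enorm (t *: x) = `|t| * enorm x.
Proof.
rewrite /enorm -sqrtr_sqr -sqrtrM ?sqr_ge0// mulr_sumr.
by congr Num.sqrt; apply: eq_bigr => i _; rewrite mxE exprMn.
Qed.

Lemma enorm_eq0 x : enorm x = 0 -> x = 0.
Proof.
move=> x0; apply/rowP => i; rewrite mxE; apply/eqP.
by rewrite -normr_le0 -x0 normr_coord_le_enorm.
Qed.

(* Cauchy-Schwarz, from [0 <= \sum_i (|y| x_i - |x| y_i) ^ 2]. *)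
Lemma enorm_dot x y : \sum_(i < d) x ord0 i * y ord0 i <= enorm x * enorm y.
Proof.
have [/enorm_eq0->|x0] := eqVneq (enorm x) 0.
  by rewrite big1 ?mulr_ge0 ?enorm_ge0// => i _; rewrite mxE mul0r.
have [/enorm_eq0->|y0] := eqVneq (enorm y) 0.
  by rewrite big1 ?mulr_ge0 ?enorm_ge0// => i _; rewrite mxE mulr0.
have xy_gt0 : 0 < enorm x * enorm y by rewrite mulr_gt0 ?lt0r ?x0 ?y0 ?enorm_ge0.
have : 0 <= \sum_(i < d) (enorm y * x ord0 i - enorm x * y ord0 i) ^+ 2.
  by apply: sumr_ge0 => i _; rewrite sqr_ge0.
rewrite (eq_bigr (fun i => enorm y ^+ 2 * x ord0 i ^+ 2 +
   enorm x ^+ 2 * y ord0 i ^+ 2 -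
   2 * (enorm x * enorm y) * (x ord0 i * y ord0 i))); last by move=> i _; ring.
rewrite sumrB big_split /= -!mulr_sumr -!sqr_enorm => ge0.
rewrite -(ler_pM2l xy_gt0).
set s := \sum_(i < d) _ in ge0 *; lra.
Qed.

Lemma enormD x y : enorm (x + y) <= enorm x + enorm y.
Proof.
rewrite -(@ler_pXn2r _ 2) ?nnegrE ?addr_ge0 ?enorm_ge0// sqr_enorm sqrrD !sqr_enorm.
rewrite (eq_bigr (fun i => x ord0 i ^+ 2 + x ord0 i * y ord0 i *+ 2 +
   y ord0 i ^+ 2)); last by move=> i _; rewrite mxE sqrrD.
by rewrite big_split /= big_split /= sumrMnl lerD2r lerD2l lerMn2r enorm_dot.
Qed.

Lemma enorm_box r x : 0 <= r -> box (fun=> r) x -> enorm x <= Num.sqrt d%:R * r.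
Proof.
move=> r_ge0 xr; rewrite -(ger0_norm r_ge0) -sqrtr_sqr -sqrtrM ?ler0n//.
apply: ler_wsqrtr; rewrite mulr_natl -[X in _ *+ X]card_ord -sumr_const.
apply: ler_sum => i _; rewrite -[x _ _ ^+ 2]real_normK ?num_real//.
by rewrite ler_pXn2r ?nnegrE.
Qed.

Lemma continuous_enorm : continuous (@enorm R d).
Proof.
move=> x; apply: (@continuous_comp _ _ _
  (fun y : 'rV[R]_d => \sum_(i < d) y ord0 i ^+ 2)); last exact: sqrt_continuous.
apply: continuous_big => [|i _ y]; first exact: add_continuous.
exact: (continuous_comp (@coord_continuous _ _ _ ord0 i y)
  (@exprn_continuous _ 2 _)).
Qed.

Lemma compact_closed_eball c r : compact (closed_eball c r).
Proof.
apply: bounded_closed_compact.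
  (* Boundedness refers to the sup norm, which [enorm] dominates coordinate by coordinate. *)
  exists (`|c| + `|r|); split; first by rewrite num_real.
  move=> M ltM x xr /=; apply/ltW/(le_lt_trans _ ltM).
  rewrite -[x](subrK c) addrC (le_trans (ler_normD _ _))// lerD2l.
  rewrite [`|x - c|]mx_normrE; apply: bigmax_le => //= -[i j] _.
  rewrite ord1; apply: le_trans (normr_coord_le_enorm _ _) _.
  exact: le_trans xr (ler_norm _).
rewrite (_ : closed_eball c r =
   (fun x => enorm (x - c)) @^-1` [set t | t <= r]) //.
apply: closed_comp (@closed_le _ r).
move=> x _.
apply: continuous_comp; last exact: continuous_enorm.
exact: translation_continuous.
Qed.

End EuclideanNorm.

(** * Uniform continuity near a compact set *)

Section UniformContinuity.
Variables (R : realType) (V : normedModType R).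

(** Only [x] is confined to [K]; [x + y] may leave it. Joint continuity at each [(x, 0)] and
    compactness yield one neighbourhood of 0 for all [x]. *)
Lemma compact_unif_continuous_shift (K : set V) (g : V -> R) (e : R) :
  compact K -> continuous g -> 0 < e ->
  \forall y \near (0 : V), forall x, K x -> `|g (x + y) - g x| <= e.
Proof.
move=> /compact_near_coveringP Kc gc e_gt0.
apply: (Kc _ _ (fun y x => `|g (x + y) - g x| <= e)) => x Kx.
have gcvg : (fun p : V * V => `|g (p.1 + p.2) - g p.1|) @ (x, 0 : V) -->
    `|g (x + 0) - g x|.
  apply: cvg_norm; apply: cvgB.
    apply: (@cvg_comp _ _ _ (fun p : V * V => p.1 + p.2) g) (gc (x + 0)).
    by apply: cvgD; [exact: cvg_fst|exact: cvg_snd].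
  by apply: (@cvg_comp _ _ _ (fun p : V * V => p.1) g) (gc x); exact: cvg_fst.
by have := cvgr_le _ gcvg e; rewrite addr0 subrr normr0; apply.
Qed.

End UniformContinuity.

(** * Second differences along a coordinate axis *)

Section SecondDifference.
Variables (R : realType) (d : nat).
Implicit Types (f : 'rV[R]_d -> R) (x : 'rV[R]_d) (i : 'I_d).

Lemma is_derive_line f i x t :
  derivable f (x + t *: delta_mx ord0 i) (delta_mx ord0 i) ->
  is_derive t (1 : R) (fun s => f (x + s *: delta_mx ord0 i))
    (partial i f (x + t *: delta_mx ord0 i)).
Proof.
set v := delta_mx ord0 i => df.
have quotE : (fun h : R => h^-1 *: (((fun s => f (x + s *: v)) \o shift t) (h *: 1)
      - f (x + t *: v)))
    = (fun h : R => h^-1 *: ((f \o shift (x + t *: v)) (h *: v) - f (x + t *: v))).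
  apply/funext => h /=; congr (_ *: (f _ - _)).
  by rewrite scalerDl [h *: 1]mulr1 addrCA.
by split; rewrite /derivable /derive quotE.
Qed.

Lemma continuous_line f x v :
  continuous f -> continuous (fun t : R => f (x + t *: v)).
Proof.
move=> fc t.
apply: (@cvg_comp _ _ _ (fun t : R => x + t *: v) f) (fc (x + t *: v)).
by apply: cvgD; [exact: cvg_cst|apply: cvgZr_tmp; exact: cvg_id].
Qed.

(** Two mean value theorems: the second difference is the increment over [[0, h]] of
    [u s - u (s - h)], whose derivative is an increment of [u'] over a length [h]. *)
Lemma second_diff_mean f i x h : smooth f -> 0 < h ->
  exists2 t, `|t| <= h &
    f (x + h *: delta_mx ord0 i) + f (x - h *: delta_mx ord0 i) - 2 * f x =
    h ^+ 2 * partial i (partial i f) (x + t *: delta_mx ord0 i).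
Proof.
set v := delta_mx ord0 i => fs h_gt0.
have [fc df] := fs [::]; have [f'c df'] := fs [:: i].
pose u t := f (x + t *: v); pose u' t := partial i f (x + t *: v).
pose u'' t := partial i (partial i f) (x + t *: v).
have du t : is_derive t (1 : R) u (u' t) by apply/is_derive_line/df.
have du' t : is_derive t (1 : R) u' (u'' t) by apply/is_derive_line/df'.
have dw t : is_derive t (1 : R) (fun s => u s - u (s - h)) (u' t - u' (t - h)).
  apply: is_deriveB; rewrite -[u' (t - h)]mulr1.
  apply: (@is_derive1_comp _ u (fun s => s - h)).
  by rewrite -[X in is_derive _ _ _ X]subr0; apply: is_deriveB.
have uc : continuous u by apply: continuous_line.
have u'c : continuous u' by apply: continuous_line.
have wc : {within `[0, h], continuous (fun s => u s - u (s - h))}.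
  apply: continuous_subspaceT => t; apply: cvgB; first exact: uc.
  apply: (@cvg_comp _ _ _ (fun t : R => t - h) u) (uc (t - h)).
  exact: (@translation_continuous R R^o).
have [t1] := MVT h_gt0 (fun t _ => dw t) wc.
rewrite in_itv /= subrr sub0r subr0 => /andP[t1_gt0 t1_lt] eq1.
have lt_t1 : t1 - h < t1 by rewrite gtrBl.
have u'wc : {within `[t1 - h, t1], continuous u'} by exact: continuous_subspaceT.
have [t2] := MVT lt_t1 (fun t _ => du' t) u'wc.
rewrite in_itv /= opprB addrCA subrr addr0 => /andP[t2_gt t2_lt] eq2.
exists t2; first by rewrite ler_norml; lra.
rewrite -/(u'' t2); transitivity (u h - u 0 - (u 0 - u (- h))).
  by rewrite /u scale0r addr0 scaleNr; ring.
rewrite eq1 eq2; ring.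
Qed.
End SecondDifference.

(** * Chord estimates *)

Section Trigonometry.
Variable R : realType.

Lemma sin_le (t : R) : 0 <= t -> sin t <= t.
Proof.
move=> t_ge0.
have sinc : {within `[0, t], continuous (@sin R)}.
  exact/continuous_subspaceT/continuous_sin.
have [c _] := MVT_segment t_ge0 (fun x _ => is_derive_sin x) sinc.
rewrite sin0 !subr0 => ->.
by rewrite -[leRHS]mul1r ler_wpM2r// cos_le1.
Qed.

(** The left side is [4 sin^2 (t / 2)], the squared chord of the arc [t] on the unit circle. *)
Lemma chord_le (t : R) : 0 <= t <= pi -> 2 - 2 * cos t <= t ^+ 2.
Proof.
move=> /andP[t_ge0 t_le].
set s := t / 2; have tE : t = s + s by rewrite /s; field.
have s_ge0 : 0 <= s by rewrite divr_ge0.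
have sin_s : 0 <= sin s.
  by apply: sin_ge0_pi; rewrite s_ge0 /s; have := pi_gt0 R; lra.
have sin_s_le : sin s ^+ 2 <= s ^+ 2 by rewrite ler_pXn2r ?nnegrE ?sin_le.
rewrite tE cosD -!expr2 cos2sin2.
have -> : (s + s) ^+ 2 = 4 * s ^+ 2 by ring.
by lra.
Qed.

Lemma chord_gt0 n : (0 < n)%N -> 0 < 2 - 2 * cos (angle R n).
Proof.
move=> n_gt0; rewrite -(pmulr_rgt0 _ (sin_mass_gt0 R n_gt0)) sin_massE.
by have := sin_angle_gt0 R (Ordinal n_gt0); rewrite mul1r => ?; rewrite mulr_gt0.
Qed.

End Trigonometry.

(** * Averages that almost annihilate one eigenfunction *)

Section AnnihilatingAverage.
Variables (R : realType) (d : nat).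
Hypotheses (d_gt0 : (0 < d)%N) (d_le4 : (d <= 4)%N).
Variables (lam : R) (phi : 'rV[R]_d -> R).
Hypotheses (lam_gt0 : 0 < lam) (phi_smooth : smooth phi).
Hypothesis (phi_eigen : forall x, - laplacian phi x = lam * phi x).

(* Chosen so that [lam * mesh n ^+ 2 = d * (2 - 2 * cos (angle n))]: the terms in
   [phi x] then cancel exactly in the sum over [i] of the second differences. *)
Definition mesh n : R := Num.sqrt (d%:R * (2 - 2 * cos (angle R n)) / lam).

Lemma sqr_mesh n : (0 < n)%N ->
  lam * mesh n ^+ 2 = d%:R * (2 - 2 * cos (angle R n)).
Proof.
move=> n_gt0; have c_gt0 := chord_gt0 R n_gt0.
rewrite sqr_sqrtr; first by field; rewrite gt_eqF.
by rewrite divr_ge0 ?(ltW lam_gt0)// mulr_ge0 ?(ltW c_gt0).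
Qed.

Lemma mesh_gt0 n : (0 < n)%N -> 0 < mesh n.
Proof.
move=> n_gt0; have c_gt0 := chord_gt0 R n_gt0.
by rewrite sqrtr_gt0 divr_gt0// mulr_gt0// ltr0n.
Qed.

Lemma mesh_le n : mesh n <= Num.sqrt (d%:R / lam) * angle R n.
Proof.
have angle_ge0 : 0 <= angle R n by rewrite divr_ge0 ?pi_ge0.
have angle_le : angle R n <= pi.
  by rewrite ler_pdivrMr// ler_peMr ?pi_ge0// ler1n.
rewrite -[X in _ * X]ger0_norm// -sqrtr_sqr -sqrtrM; last first.
  by rewrite divr_ge0// ltW.
apply: ler_wsqrtr; rewrite mulrAC ler_wpM2l//.
  by rewrite divr_ge0// ltW.
by rewrite chord_le// angle_ge0.
Qed.

Lemma half_width_mesh_ge0 n : 0 <= half_width (mesh n) n.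
Proof. by rewrite divr_ge0 ?mulr_ge0 ?sqrtr_ge0. Qed.

(** By [mesh_le] the half-side never exceeds its limit value [(pi / 2) sqrt (d / lam)], so one
    radius serves all [n]; [d <= 4] then bounds the half-diagonal. *)
Lemma enorm_half_width n (x : 'rV[R]_d) :
  box (fun=> half_width (mesh n) n) x ->
  enorm x <= 2%:R * pi * (1 / Num.sqrt lam).
Proof.
move=> /(enorm_box (half_width_mesh_ge0 n)) /le_trans; apply.
have sqrtd_ge0 : 0 <= Num.sqrt (d%:R : R) by exact: sqrtr_ge0.
have : half_width (mesh n) n <= Num.sqrt (d%:R / lam) * pi / 2.
  rewrite /half_width ler_pM2r ?invr_gt0// mulrC -ler_pdivlMr ?ltr0n//.
  by rewrite -mulrA mesh_le.
move=> /(ler_wpM2l sqrtd_ge0) /le_trans; apply.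
rewrite sqrtrM// sqrtrV ?(ltW lam_gt0)//.
have -> : Num.sqrt (d%:R : R) * (Num.sqrt d%:R / Num.sqrt lam * pi / 2) =
    (Num.sqrt (d%:R : R)) ^+ 2 * (pi / Num.sqrt lam / 2) by ring.
rewrite sqr_sqrtr//.
have -> : 2%:R * pi * (1 / Num.sqrt lam) = 4 * (pi / Num.sqrt lam / 2).
  by field; rewrite gt_eqF ?sqrtr_gt0.
rewrite ler_wpM2r ?ler_nat//.
by rewrite !divr_ge0 ?pi_ge0 ?sqrtr_ge0.
Qed.

(** Each second difference is compared with the second partial derivative at [x]. The bound keeps
    the chord factor so that it cancels in [weighted_sum_cube_weights]. *)
Lemma sum_second_diff_le n e (K : set 'rV[R]_d) : (0 < n)%N ->
  (forall i t x, `|t| <= mesh n -> K x ->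
     `|partial i (partial i phi) (x + t *: unitv R i) -
       partial i (partial i phi) x| <= e) ->
  forall x, K x ->
  `|\sum_(i < d) second_diff (unitv R i) (mesh n) n phi x| <=
    (2 - 2 * cos (angle R n)) * (d%:R / lam * (d%:R * e)).
Proof.
move=> n_gt0 near_e x Kx.
have d_neq0 : d%:R != 0 :> R by rewrite pnatr_eq0 -lt0n.
have h2E : mesh n ^+ 2 = (2 - 2 * cos (angle R n)) * (d%:R / lam).
  by apply: (mulfI (lt0r_neq0 lam_gt0)); rewrite sqr_mesh//; field; rewrite gt_eqF.
have cosE : 2 - 2 * cos (angle R n) = lam * mesh n ^+ 2 / d%:R.
  by rewrite sqr_mesh// mulrAC mulfV// mul1r.
rewrite mulrA -h2E.
have -> : \sum_(i < d) second_diff (unitv R i) (mesh n) n phi x =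
  \sum_(i < d) (phi (x + mesh n *: unitv R i) + phi (x - mesh n *: unitv R i)
     - 2 * phi x - mesh n ^+ 2 * partial i (partial i phi) x).
  (* With the choice of [mesh], this sum cancels the terms in [phi x] left by the cosine
     coefficients. *)
  have lapE : \sum_(i < d) mesh n ^+ 2 * partial i (partial i phi) x =
      - (lam * mesh n ^+ 2 * phi x).
    by rewrite -mulr_sumr (mulrAC lam) -phi_eigen mulNr opprK mulrC.
  rewrite [RHS]sumrB lapE opprK.
  transitivity (\sum_(i < d) (phi (x + mesh n *: unitv R i) +
    phi (x - mesh n *: unitv R i) - 2 * phi x) +
    \sum_(i < d) (2 - 2 * cos (angle R n)) * phi x).
    by rewrite -big_split; apply: eq_bigr => i _; rewrite /second_diff /=; ring.
  rewrite sumr_const card_ord cosE -[X in _ + X = _]mulr_natr; congr (_ + _).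
  by field.
apply: le_trans (ler_norm_sum _ _ _) _.
have -> : mesh n ^+ 2 * (d%:R * e) = \sum_(i < d) mesh n ^+ 2 * e.
  by rewrite sumr_const card_ord -[RHS]mulr_natr; ring.
apply: ler_sum => i _.
have [t th ->] := second_diff_mean i x phi_smooth (mesh_gt0 n_gt0).
rewrite -mulrBr normrM ger0_norm ?sqr_ge0// ler_wpM2l ?sqr_ge0//.
exact: near_e.
Qed.

Lemma small_mesh (r : R) : 0 < r -> exists2 n, (0 < n)%N & mesh n < r.
Proof.
move=> r_gt0; set s := Num.sqrt (d%:R / lam) * pi.
exists (Num.bound (s / r)).+1 => //; apply: le_lt_trans (mesh_le _) _.
rewrite mulrA -/s ltr_pdivrMr ?ltr0n// mulrC -ltr_pdivrMr//.
apply: lt_trans (archi_boundP _) _; last by rewrite ltr_nat ltnS leqnSn.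
by rewrite divr_ge0 ?(ltW r_gt0)// mulr_ge0 ?sqrtr_ge0 ?pi_ge0.
Qed.

Lemma norm_unitv (t : R) (i : 'I_d) : `|t *: unitv R i| <= `|t|.
Proof.
rewrite [leLHS]mx_normrE; apply: bigmax_le => //= -[j k] _ /=.
by rewrite !mxE normrM ler_piMr//; case: (_ && _); rewrite ?normr1 ?normr0.
Qed.

Lemma exists_annihilating_average (c : 'rV[R]_d) (r e : R) : 0 < e ->
  exists2 w, average [set y | enorm y <= 2%:R * pi * (1 / Num.sqrt lam)] w &
    forall x, enorm (x - c) <= r -> `|weighted_sum w phi x| <= e.
Proof.
move=> e_gt0; set rho := 2%:R * pi * _.
have d_gt0R : 0 < d%:R :> R by rewrite ltr0n.
(* Solves [d / lam * (d * e') = d * e]; the factor [d%:R^-1] in Green's identity then leaves [e]. *)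
pose e' := e * lam / d%:R.
have e'_gt0 : 0 < e' by rewrite divr_gt0 ?mulr_gt0.
(* Enlarged by [rho] because the second differences are taken at [x + y] with [y] in the cube. *)
pose K := closed_eball c (r + rho).
have : \forall y \near (0 : 'rV[R]_d), forall i : 'I_d, forall x, K x ->
    `|partial i (partial i phi) (x + y) - partial i (partial i phi) x| <= e'.
  have Kc : compact K := @compact_closed_eball _ _ c (r + rho).
  apply: (@filter_forall _ _ _ _ (nbhs_filter (0 : 'rV[R]_d))) => i.
  have [phi2c _] := phi_smooth [:: i; i].
  exact: (compact_unif_continuous_shift Kc phi2c e'_gt0).
move=> /nbhs_ballP[s /= s_gt0 near_e].
have [n n_gt0 h_lt] := small_mesh s_gt0.
have h_ge0 := ltW (mesh_gt0 n_gt0).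
exists (cube_weights d (mesh n) n).
  apply: average_sub (average_cube_weights d_gt0 n_gt0 h_ge0).
  exact: enorm_half_width.
move=> x xr; rewrite -(ler_pM2l (chord_gt0 R n_gt0)).
rewrite -[X in X * _ <= _]ger0_norm ?(ltW (chord_gt0 R n_gt0))// -normrM.
rewrite weighted_sum_cube_weights// normrM ger0_norm ?invr_ge0//.
rewrite mulrC ler_pdivrMr//.
apply: average_norm_weighted_sum (average_prod_weights_enum d n_gt0 h_ge0) _ => y yb.
have := @sum_second_diff_le n e' K n_gt0 _ (x + y) _.
rewrite (_ : d%:R / lam * (d%:R * e') = e * d%:R) ?mulrA; last first.
  by rewrite /e'; field; rewrite !gt_eqF.
apply.
  move=> i t z th Kz; apply: near_e => //.
  rewrite -ball_normE /= sub0r normrN.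
  by apply: le_lt_trans (norm_unitv _ _) _; apply: le_lt_trans h_lt.
rewrite /K /closed_eball /= addrAC; apply: le_trans (enormD _ _) _.
by rewrite lerD// (enorm_half_width yb).
Qed.

End AnnihilatingAverage.

(** * Sums of eigenfunctions and composed averages *)

Section EigenSum.
Variables (R : realType) (d : nat).
Hypotheses (d_gt0 : (0 < d)%N) (d_le4 : (d <= 4)%N).

Lemma average_conv_all_eball (I : eqType) (rho : I -> R)
    (w : I -> seq (R * 'rV[R]_d)) (s : seq I) :
  (forall i, average [set y | enorm y <= rho i] (w i)) ->
  average [set y | enorm y <= \sum_(i <- s) rho i] (conv_all w s).
Proof.
move=> avw; elim: s => [|i s IH] /=.
  apply: average_unit; rewrite /= big_nil -[0 : 'rV__](scale0r 0) enormZ.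
  by rewrite normr0 mul0r.
apply: average_conv (avw i) IH => x y /= xi ys.
by rewrite big_cons; apply: le_trans (enormD _ _) _; rewrite lerD.
Qed.

Variables (n : nat) (lam : 'I_n -> R) (phi : 'I_n -> 'rV[R]_d -> R).
Hypotheses (lam_gt0 : forall k, 0 < lam k) (phi_smooth : forall k, smooth (phi k)).
Hypothesis phi_eigen : forall k x, - laplacian (phi k) x = lam k * phi k x.

Lemma continuous_eigen_sum (a : 'I_n -> R) :
  continuous (fun x => \sum_(k < n) a k * phi k x).
Proof.
apply: continuous_big => [|k _ x]; first exact: add_continuous.
have [phic _] := phi_smooth k [::].
by apply: continuousM; [exact: cst_continuous|exact: phic].
Qed.

(** Were the minimum of [f] on the ball positive, the composed average of [f] at [c] would be at
    least that minimum, whereas every term is made arbitrarily small by its own factor. *)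
Lemma eigen_sum_le0 (a : 'I_n -> R) (c : 'rV[R]_d) :
  exists2 x, closed_eball c (2%:R * pi * \sum_(k < n) 1 / Num.sqrt (lam k)) x &
    \sum_(k < n) a k * phi k x <= 0.
Proof.
pose rho k : R := 2%:R * pi * (1 / Num.sqrt (lam k)).
have rho_ge0 k : 0 <= rho k.
  by rewrite mulr_ge0 ?divr_ge0 ?mulr_ge0 ?pi_ge0 ?sqrtr_ge0.
rewrite mulr_sumr -/(rho _); set r := \sum_(k < n) rho k.
have rE : \sum_(k <- enum 'I_n) rho k = r by rewrite big_enum.
set B := closed_eball c r; set f := fun x => \sum_(k < n) a k * phi k x.
have B0 : B !=set0.
  exists c; rewrite /B /closed_eball /= subrr -[0 : 'rV__](scale0r 0) enormZ.
  by rewrite normr0 mul0r sumr_ge0.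
have fc : continuous f by exact: continuous_eigen_sum.
have [x0 Bx0 minx0] := compact_EVT_min B0 (@compact_closed_eball _ _ c r)
  (continuous_subspaceT fc).
exists x0; first exact: set_mem.
rewrite leNgt; apply/negP => f_gt0.
set A := \sum_(k < n) `|a k|.
have A_ge0 : 0 <= A by exact: sumr_ge0.
have A1_gt0 : 0 < A + 1 by lra.
(* Makes [A * e < f x0]; adding 1 keeps the denominator positive even if [A = 0]. *)
set e := f x0 / (A + 1); have e_gt0 : 0 < e by rewrite divr_gt0.
have /choice[w wP] k : exists wk, average [set y | enorm y <= rho k] wk /\
    forall x, enorm (x - c) <= r -> `|weighted_sum wk (phi k) x| <= e.
  have [wk ? ?] := exists_annihilating_average d_gt0 d_le4 (lam_gt0 k)
    (phi_smooth k) (phi_eigen k) c r e_gt0.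
  by exists wk.
have avw k : average [set y | enorm y <= rho k] (w k) by have [] := wP k.
have low : f x0 <= weighted_sum (conv_all w (enum 'I_n)) f c.
  apply: average_le_weighted_sum
    (average_conv_all_eball (enum 'I_n) avw) _ => y /= yr.
  apply: minx0; rewrite inE /B /closed_eball /= addrAC subrr add0r.
  by rewrite -rE.
have up : weighted_sum (conv_all w (enum 'I_n)) f c <= A * e.
  rewrite weighted_sum_sum mulr_suml; apply: ler_sum => k _; rewrite weighted_sumZ.
  apply: le_trans (ler_norm _) _; rewrite normrM ler_wpM2l//.
  (* Factor [k] acts first; the others evaluate the result within the sum of their radii from [c],
     hence inside the ball where it is at most [e]. *)
  rewrite (weighted_sum_conv_all_rem _ _ _ (mem_enum _ k)).
  apply: average_norm_weighted_sum
    (average_conv_all_eball (rem k (enum 'I_n)) avw) _ => y /= yr.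
  have [_] := wP k; apply; rewrite addrAC subrr add0r; apply: le_trans yr _.
  rewrite -rE (perm_big _ (perm_to_rem (mem_enum _ k))).
  by rewrite big_cons lerDr.
have : A * e < f x0.
  by rewrite /e mulrA ltr_pdivrMr// [A * _]mulrC ltr_pM2l ?ltrDl.
by rewrite ltNge (le_trans low up).
Qed.

End EigenSum.

(** * A zero on a segment joining points of either sign *)

Theorem theorem3 (R : realType) (d : nat) (hd : d = 2%N \/ d = 3%N)
  (n : nat) (hn : (1 <= n)%N)
  (lam : 'I_n -> R) (hlam : forall k : 'I_n, 0 < lam k)
  (phi : 'I_n -> 'rV[R]_d -> R)
  (hsmooth : forall k : 'I_n, smooth (phi k))
  (hphi : forall (k : 'I_n) (x : 'rV[R]_d),
     - laplacian (phi k) x = lam k * phi k x)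
  (a : 'I_n -> R) (c : 'rV[R]_d) :
  exists2 x : 'rV[R]_d,
    closed_eball c (2%:R * pi * \sum_(k < n) 1 / Num.sqrt (lam k)) x &
    \sum_(k < n) a k * phi k x = 0.
Proof.
have d_gt0 : (0 < d)%N by case: hd => ->.
have d_le4 : (d <= 4)%N by case: hd => ->.
set r := 2%:R * pi * _; pose f x := \sum_(k < n) a k * phi k x.
have [x xr fx] := eigen_sum_le0 d_gt0 d_le4 hlam hsmooth hphi a c.
(* Negated coefficients turn [f] into [- f], giving a point where [f] is nonnegative. *)
have [y yr fy] := eigen_sum_le0 d_gt0 d_le4 hlam hsmooth hphi (fun k => - a k) c.
have {fy} fy : 0 <= f y.
  by rewrite -oppr_le0 -sumrN; under eq_bigr do rewrite -mulNr.
pose u (t : R) := f (x + t *: (y - x)).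
have uc : {within `[0, 1], continuous u}.
  apply: continuous_subspaceT.
  exact/continuous_line/(continuous_eigen_sum hsmooth).
have u0 : u 0 = f x by rewrite /u scale0r addr0.
have u1 : u 1 = f y by rewrite /u scale1r addrC subrK.
have /(IVT ler01 uc)[t] : Num.min (u 0) (u 1) <= 0 <= Num.max (u 0) (u 1).
  by rewrite u0 u1 ge_min fx le_max fy orbT.
rewrite in_itv /= => /andP[t_ge0 t_le1] ut0.
exists (x + t *: (y - x)) => //; rewrite /closed_eball /=.
(* A convex combination of [x - c] and [y - c]: the segment stays in the ball. *)
have -> : x + t *: (y - x) - c = (1 - t) *: (x - c) + t *: (y - c).
  by apply/rowP => i; rewrite !mxE; ring.
apply: le_trans (enormD _ _) _; rewrite !enormZ !ger0_norm ?subr_ge0//.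
have -> : r = (1 - t) * r + t * r by ring.
by rewrite lerD ?ler_wpM2l ?subr_ge0.
Qed.
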